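(* Let $C$ be a finite power associative loop and let $m\ge 1$ be an integer. Then the probability $p_m(C)=|C|^{-m}\cdot|\mathrm{Gen}_m(C)|$ that $m$ randomly chosen elements of $C$ generate $C$ satisfies $$p_m(C)=|C|^{-m}\sum_{[\mathbf a]\in \mathrm{Gen}_m(C)/\sim}\ \prod_{i=0}^{m-1}\Gamma(A_i,A_{i+1}),$$ where the sum runs over the $\sim$-equivalence classes contained in $\mathrm{Gen}_m(C)$, and for each class $\{A_i\}_{i=0}^m$ is the sequence of nested subloops associated with a chosen representative $\mathbf a$ of the class.
   Context: A loop $C$ is power associative if every element of $C$ generates a group. For subloops and elements, $\langle\,\cdot\,\rangle$ denotes the subloop of $C$ generated by the given data. Given $\mathbf a=(a_0,\dots,a_{m-1})\in C^m$, the associated sequence of nested subloops $\{A_i\}_{i=0}^m$ is defined by letting $A_0=\{e\}$ be the smallest subloop of $C$ and $A_{i+1}=\langle A_i,a_i\rangle$ for $0\le i\le m-1$. $\mathrm{Gen}_m(C)$ is the set of all $\mathbf a\in C^m$ with $A_m=C$. $\mathrm{Aut}(C)$ acts naturally on the lattice of subloops of $C$; $O_B$ denotes the orbit of a subloop $B\le C$. For $A,B\le C$, $\Gamma(A,B)$ is the number of elements $x\in C$ such that $\langle A,x\rangle\in O_B$. Two tuples $\mathbf a,\mathbf b\in C^m$ with associated sequences $\{A_i\}$, $\{B_i\}$ are orbit-equivalent, written $\mathbf a\sim\mathbf b$, if $A_i\in O_{B_i}$ for all $0\le i\le m$. The set $\mathrm{Gen}_m(C)$ is a union of $\sim$-classes.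 *)

(* Defs.v *)
From HB Require Import structures.
From mathcomp Require Import all_boot.

Set Implicit Arguments.
Unset Strict Implicit.
Unset Printing Implicit Defensive.

Local Open Scope group_scope.

(* Loops, as unital magmas with divisions: [ldiv x y] is the unique solution  *)
(* z of x * z = y and [rdiv y x] the unique solution z of z * x = y.          *)
HB.mixin Record UMagma_isLoop C of UMagma C := {
  ldiv : C -> C -> C;
  rdiv : C -> C -> C;
  mulVKl : forall x y : C, x * ldiv x y = y;
  mulKl : forall x y : C, ldiv x (x * y) = y;
  mulVKr : forall x y : C, rdiv y x * x = y;
  mulKr : forall x y : C, rdiv (y * x) x = y
}.

#[short(type="finLoopType")]
HB.structure Definition FinLoop :=
  {C of UMagma_isLoop C & UMagma C & Finite C}.

(* These imports come after FinLoop, which Hierarchy Builder would otherwise  *)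
(* reject: fingroup.v declares no join of BaseUMagma and Finite.              *)
From mathcomp Require Import all_order all_algebra all_fingroup.

Import GroupScope.

Section FinLoopDefs.

Variable C : finLoopType.
Implicit Types (x y z : C) (A B S : {set C}).

Definition is_subloop B : bool :=
  (1 \in B) &&
  [forall x in B, forall y in B,
     [&& x * y \in B, ldiv x y \in B & rdiv x y \in B]].

Definition loop_gen S : {set C} :=
  \bigcap_(B : {set C} | is_subloop B && (S \subset B)) B.

Definition is_group B : Prop :=
  [/\ 1 \in B,
      {in B &, forall x y, x * y \in B},
      {in B & &, forall x y z, x * (y * z) = (x * y) * z}
    & {in B, forall x, exists2 y, y \in B & x * y = 1 /\ y * x = 1}].

Definition power_associative : Prop :=
  forall x, is_group (loop_gen [set x]).

Definition loop_aut : {set {perm C}} :=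
  [set f : {perm C} | [forall x, forall y, f (x * y) == f x * f y]].

Lemma loop_aut_group_set : group_set loop_aut.
Proof.
apply/group_setP; split=> [|f g].
  by rewrite inE; apply/'forall_forallP=> x y; rewrite !perm1.
rewrite !inE => /'forall_'forall_eqP fM /'forall_'forall_eqP gM.
by apply/'forall_'forall_eqP=> x y; rewrite !permM fM gM.
Qed.

Canonical loop_aut_group := Group loop_aut_group_set.

(* The orbit O_B, for the action of automorphisms on subsets by direct image. *)
Definition subloop_orbit B : {set {set C}} := orbit 'P^* loop_aut B.

Definition Gamma A B : nat :=
  #|[set x : C | loop_gen (x |: A) \in subloop_orbit B]|.

(* For a of size m, only the indices i <= m are meaningful. *)
Fixpoint subloop_chain (a : seq C) (i : nat) : {set C} :=
  if i is j.+1 then loop_gen (nth 1 a j |: subloop_chain a j) else [set 1].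

Definition Gen (m : nat) : {set m.-tuple C} :=
  [set a : m.-tuple C | subloop_chain a m == [set: C]].

Definition orbit_equiv (m : nat) : rel (m.-tuple C) := fun a b =>
  [forall i : 'I_m.+1,
     subloop_chain a i \in subloop_orbit (subloop_chain b i)].

Definition Gen_classes (m : nat) : {set {set m.-tuple C}} :=
  equivalence_partition (@orbit_equiv m) (Gen m).

Definition gen_prob (m : nat) : rat :=
  (#|C|%:R ^- m * #|Gen m|%:R)%R.

End FinLoopDefs.

(* Main.v *)
Require Import Defs.
From mathcomp Require Import all_boot all_order all_algebra all_fingroup.

(** The tuples orbit-equivalent to [a] are counted one entry at a time: once
    b_0, ..., b_(n-1) are chosen with B_n in the orbit of A_n, the admissible
    b_n number Gamma(B_n, A_(n+1)), and this equals Gamma(A_n, A_(n+1)) because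
    an automorphism carrying A_n to B_n permutes C and preserves orbits. Hence
    each class has the product of the Gamma's as its cardinality, and
    Gen_m(C) is the disjoint union of its classes. *)

Set Implicit Arguments.
Unset Strict Implicit.
Unset Printing Implicit Defensive.

Import GroupScope.

Section LoopGeneration.

Variable C : finLoopType.
Implicit Types (x y : C) (A B S : {set C}) (f : {perm C}).

Lemma loop_autM f x y : f \in loop_aut C -> f (x * y) = f x * f y.
Proof. by rewrite inE => /'forall_'forall_eqP. Qed.

Lemma loop_aut1 f : f \in loop_aut C -> f 1 = 1.
Proof.
move=> fA; have := loop_autM 1 1 fA; rewrite mul1g => f11.
(* [f 1] is idempotent; left division of [f 1 * f 1 = f 1 * 1] by [f 1] gives the claim. *)
by rewrite -[LHS](mulKl (f 1)) -f11 -{2}[f 1]mulg1 mulKl.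
Qed.

Lemma loop_aut_ldiv f x y : f \in loop_aut C -> f (ldiv x y) = ldiv (f x) (f y).
Proof. by move=> fA; rewrite -{2}[y](mulVKl x) loop_autM // mulKl. Qed.

Lemma loop_aut_rdiv f x y : f \in loop_aut C -> f (rdiv x y) = rdiv (f x) (f y).
Proof. by move=> fA; rewrite -{2}[x](mulVKr y) loop_autM // mulKr. Qed.

Lemma is_subloop_preim f B :
  f \in loop_aut C -> is_subloop B -> is_subloop (f @^-1: B).
Proof.
move=> fA /andP[B1 /'forall_implyP BP].
apply/andP; split; first by rewrite inE loop_aut1.
apply/'forall_implyP=> x; rewrite inE => /BP/'forall_implyP Bx.
apply/'forall_implyP=> y; rewrite inE => /Bx.
by rewrite !inE loop_autM // loop_aut_ldiv // loop_aut_rdiv.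
Qed.

(** The preimage under [f] of any subloop containing [f @: S] is a subloop containing [S]. *)
Lemma loop_gen_imset_sub f S :
  f \in loop_aut C -> f @: loop_gen S \subset loop_gen (f @: S).
Proof.
move=> fA; apply/subsetP=> _ /imsetP[x /bigcapP xS ->].
apply/bigcapP=> B /andP[BL SB].
have := xS (f @^-1: B); rewrite inE; apply.
by rewrite is_subloop_preim //= -sub_imset_pre.
Qed.

Lemma loop_gen_imset f S :
  f \in loop_aut C -> f @: loop_gen S = loop_gen (f @: S).
Proof.
move=> fA; apply/eqP; rewrite eqEsubset loop_gen_imset_sub //=.
have fVA : f^-1 \in loop_aut C by rewrite groupV.
have fK (T : {set C}) : f^-1 @: (f @: T) = T.
  by rewrite -imset_comp (eq_imset _ (permK f)) imset_id.
have fVK (T : {set C}) : f @: (f^-1 @: T) = T.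
  by rewrite -imset_comp (eq_imset _ (permKV f)) imset_id.
(* The reverse inclusion is the previous lemma for [f^-1] and [f @: S], carried back by [f]. *)
have := loop_gen_imset_sub (f @: S) fVA; rewrite fK => sub.
by rewrite -(fVK (loop_gen (f @: S))) imsetS.
Qed.

Lemma subloop_orbitP A B :
  reflect (exists2 f, f \in loop_aut C & A = f @: B) (A \in subloop_orbit B).
Proof.
by apply: (iffP orbitP) => [[f fA <-]|[f fA ->]]; exists f; rewrite //= setactE.
Qed.

Lemma subloop_orbit_imset f A B :
  f \in loop_aut C -> (f @: A \in subloop_orbit B) = (A \in subloop_orbit B).
Proof.
move=> fA; rewrite /subloop_orbit ![_ \in orbit _ _ B]orbit_sym.
by have <- : orbit 'P^* (loop_aut C) (f @: A) = orbit 'P^* (loop_aut C) A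
  by exact: (orbit_act 'P^* A fA).
Qed.

Lemma subloop_orbit1 A : (A \in subloop_orbit [set 1]) = (A == [set 1]).
Proof.
apply/subloop_orbitP/eqP => [[f fA ->]|->].
  by rewrite imset_set1 loop_aut1.
by exists 1; [exact: group1 | rewrite imset_set1 perm1].
Qed.

Lemma subloop_orbitT A : (A \in subloop_orbit [set: C]) = (A == [set: C]).
Proof.
have fT f : f @: [set: C] = [set: C].
  by apply/eqP; rewrite eqEcard subsetT (card_imset _ (@perm_inj _ f)) /=.
apply/subloop_orbitP/eqP => [[f _ ->]|->]; first exact: fT.
by exists 1; [exact: group1 | rewrite fT].
Qed.

Lemma Gamma_orbit A A' B : A' \in subloop_orbit A -> Gamma A' B = Gamma A B.
Proof.
case/subloop_orbitP=> f fA ->; rewrite /Gamma.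
rewrite -[RHS](card_imset _ (@perm_inj _ f)).
(* With y = f z, the subloop generated by [f @: A] and y is the image under [f] of the one generated
   by [A] and z. *)
apply: eq_card => y; rewrite -[y](permKV f) mem_imset; last exact: perm_inj.
by rewrite !inE -imset_set1 -imsetU -loop_gen_imset // subloop_orbit_imset.
Qed.

Lemma subloop_chain_rcons (a : seq C) x i :
  (i <= size a)%N -> subloop_chain (rcons a x) i = subloop_chain a i.
Proof. by elim: i => //= i IHi lt_ia; rewrite nth_rcons lt_ia IHi // ltnW. Qed.

Lemma rcons_tuple_bij n :
  bijective (fun p : n.-tuple C * C => [tuple of rcons p.1 p.2]).
Proof.
apply: inj_card_bij; last by rewrite card_prod !card_tuple expnSr.
move=> [s x] [t y] /(congr1 val) /= /rcons_inj[st ->].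
by congr (_, _); apply: val_inj.
Qed.

(** Taking an arbitrary sequence [A], not the chain of a tuple of length [n], keeps [A] fixed while
    [n] varies in the induction. *)
Lemma card_chain_in_orbits (A : nat -> {set C}) n : A 0 = [set 1] ->
  #|[set b : n.-tuple C | [forall i : 'I_n.+1,
       subloop_chain b i \in subloop_orbit (A i)]]|
  = (\prod_(i < n) Gamma (A i) (A i.+1))%N.
Proof.
move=> A0; elim: n => [|n IHn].
  rewrite big_ord0 -[RHS](expn0 #|C|) -card_tuple; apply: eq_card => b.
  by rewrite inE; apply/forallP => i; rewrite ord1 A0 subloop_orbit1.
(* Both sides become sums over the admissible initial segments [b]: the last [Gamma] is a constant
   summand on the right, and reindexing by [rcons] splits off the last entry on the left. *)
rewrite big_ord_recr /= -IHn -sum_nat_const -sum1_card.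
rewrite (reindex _ (onW_bij _ (rcons_tuple_bij n))) /=.
rewrite (eq_bigl (fun p : n.-tuple C * C =>
    (p.1 \in [set b : n.-tuple C | [forall i : 'I_n.+1,
       subloop_chain b i \in subloop_orbit (A i)]])
    && (loop_gen (p.2 |: subloop_chain p.1 n) \in subloop_orbit (A n.+1)))).
  rewrite -(pair_big_dep (fun b : n.-tuple C => b \in [set b : n.-tuple C |
       [forall i : 'I_n.+1, subloop_chain b i \in subloop_orbit (A i)]])
    (fun b x => loop_gen (x |: subloop_chain b n) \in subloop_orbit (A n.+1))
    (fun _ _ => 1%N)) /=.
  apply: eq_bigr => b; rewrite inE => /forallP/(_ ord_max) bn.
  by rewrite sum1_card -(Gamma_orbit _ bn) /Gamma cardsE.
move=> [b x] /=; rewrite !inE.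
have chain_last :
    subloop_chain (rcons b x) n.+1 = loop_gen (x |: subloop_chain b n).
  by rewrite /= subloop_chain_rcons ?size_tuple // nth_rcons size_tuple ltnn eqxx.
rewrite -chain_last; apply/forallP/andP => [bx | [/forallP bP xP] i].
  (* The conditions at indices up to [n] involve only [b]; the entry [x] enters only at index
     [n.+1]. *)
  split; last exact: (bx ord_max).
  apply/forallP=> i; have := bx (widen_ord (leqnSn _) i).
  by rewrite /= subloop_chain_rcons // size_tuple -ltnS.
case: (ltngtP i n.+1) (ltn_ord i) => [lt_in _| |-> //]; last first.
  by move=> lt_ni; rewrite ltnS leqNgt lt_ni.
by rewrite subloop_chain_rcons ?size_tuple //; exact: (bP (Ordinal lt_in)).
Qed.

Lemma orbit_equiv_equivalence m : equivalence_rel (@orbit_equiv C m).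
Proof.
move=> a b c; split; first by apply/forallP=> i; apply: orbit_refl.
move=> /forallP ab; apply: eq_forallb => i.
by have := ab i; rewrite /subloop_orbit => /orbit_eqP abi;
  rewrite orbit_sym abi orbit_sym.
Qed.

Lemma orbit_equiv_Gen m (a b : m.-tuple C) :
  a \in Gen C m -> orbit_equiv a b -> b \in Gen C m.
Proof.
(* Index [m] compares the last terms of the chains, and the whole loop is alone in its orbit. *)
rewrite !inE => /eqP aT /forallP/(_ ord_max) /=.
by rewrite aT /subloop_orbit orbit_sym subloop_orbitT.
Qed.

Lemma Gen_classes_partition m : partition (Gen_classes C m) (Gen C m).
Proof.
by apply: equivalence_partitionP => a b c _ _ _; apply: orbit_equiv_equivalence.
Qed.

(** Classes are formed inside [Gen C m], while [card_chain_in_orbits] counts among all tuples; the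
    two agree because [Gen C m] is closed under the equivalence. *)
Lemma Gen_class_mem m (K : {set m.-tuple C}) (a : m.-tuple C) :
  K \in Gen_classes C m -> a \in K -> K = [set b | orbit_equiv b a].
Proof.
case/imsetP=> c cG ->; rewrite inE => /andP[aG ca].
have equivS (s t : m.-tuple C) : orbit_equiv s t = orbit_equiv t s.
  by apply: eq_forallb => i; rewrite /subloop_orbit orbit_sym.
apply/setP=> b; rewrite [LHS]inE [RHS]inE (equivS b).
rewrite ((orbit_equiv_equivalence c a b).2 ca).
by apply: andb_idl => /(orbit_equiv_Gen aG).
Qed.

Lemma card_Gen_class m (K : {set m.-tuple C}) (a : m.-tuple C) :
  K \in Gen_classes C m -> a \in K ->
  #|K| = (\prod_(i < m) Gamma (subloop_chain a i) (subloop_chain a i.+1))%N.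
Proof. by move=> KG aK; rewrite (Gen_class_mem KG aK) -card_chain_in_orbits. Qed.

End LoopGeneration.

Theorem mainTheorem1 (C : finLoopType) (m : nat)
    (rep : {set m.-tuple C} -> m.-tuple C) :
  power_associative C ->
  (0 < m)%N ->
  (forall K : {set m.-tuple C}, K \in Gen_classes C m -> rep K \in K) ->
  gen_prob C m =
    (#|C|%:R ^- m *
     (\sum_(K in Gen_classes C m)
        \prod_(i < m)
          Gamma (subloop_chain (rep K) i) (subloop_chain (rep K) i.+1))%N%:R)%R.
Proof.
move=> _ _ repP; rewrite /gen_prob (card_partition (Gen_classes_partition C m)).
congr (_ * _%:R)%R; apply: eq_bigr => K KG.
exact: card_Gen_class KG (repP K KG).
Qed.
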